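(* Let $R=(g,f)$ be an ordinary Riordan array with general term $T_{n,k}=[x^n]\,g(x)f(x)^k$, $n,k\ge 0$. Let $A=(A_{n,k})_{n,k\ge 0}$ and $B=(B_{n,k})_{n,k\ge 0}$ be the matrices defined by $$A_{n,k}=T_{n+k,2k},\qquad B_{n,k}=T_{n+k+1,2k+1}.$$ Then $A$ and $B$ are ordinary Riordan arrays, namely $$A=\left(g,\frac{f^2}{x}\right),\qquad B=\left(g\,\frac{f}{x},\frac{f^2}{x}\right),$$ and moreover $$B=\left(\frac{f}{x},x\right)\cdot A .$$
   Context: An ordinary Riordan array $(g,f)$ is the infinite lower-triangular integer matrix $(T_{n,k})_{n,k\ge 0}$ with $T_{n,k}=[x^n]\,g(x)f(x)^k$, where $g,f$ are formal power series over the integers with $g(x)=1+g_1x+g_2x^2+\cdots$ and $f(x)=x+f_2x^2+f_3x^3+\cdots$, and $[x^n]$ denotes extraction of the coefficient of $x^n$. The product of Riordan arrays is $(g,f)\cdot(h,l)=(g\,(h\circ f),\,l\circ f)$. The matrix $A$ is obtained from $R$ by taking every second column starting with the first column (column index $0$) and raising the columns so as to obtain a lower-triangular matrix; $B$ is obtained in the same way starting with the second column (column index $1$). *)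

(* Defs.v *)
From HB Require Import structures.
From mathcomp Require Import all_boot all_order all_algebra.
From mathcomp Require Import boolp.

Set Implicit Arguments.
Unset Strict Implicit.
Unset Printing Implicit Defensive.

Import GRing.Theory.
Local Open Scope ring_scope.

(* Formal power series over the integers: u n is the coefficient of x^n. *)
Record fps := FPS { coef_fps :> nat -> int }.

HB.instance Definition _ := gen_eqMixin fps.
HB.instance Definition _ := gen_choiceMixin fps.

Lemma fpsP (u v : fps) : u =1 v <-> u = v.
Proof. by split=> [|-> //]; case: u v => [u] [v] /funext /= ->. Qed.

Definition fps_zero := FPS (fun=> 0).
Definition fps_opp (u : fps) := FPS (fun n => - u n).
Definition fps_add (u v : fps) := FPS (fun n => u n + v n).

Fact fps_addA : associative fps_add.
Proof. by move=> u v w; apply/fpsP => n /=; rewrite addrA. Qed.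
Fact fps_addC : commutative fps_add.
Proof. by move=> u v; apply/fpsP => n /=; rewrite addrC. Qed.
Fact fps_add0 : left_id fps_zero fps_add.
Proof. by move=> u; apply/fpsP => n /=; rewrite add0r. Qed.
Fact fps_addN : left_inverse fps_zero fps_opp fps_add.
Proof. by move=> u; apply/fpsP => n /=; rewrite addNr. Qed.

HB.instance Definition _ :=
  GRing.isZmodule.Build fps fps_addA fps_addC fps_add0 fps_addN.

Definition fps_one := FPS (fun n => (n == 0%N)%:R).
Definition fps_mul (u v : fps) :=
  FPS (fun n => \sum_(i < n.+1) u i * v (n - i)%N).

(* Truncation to a polynomial of degree at most n; it reduces the ring axioms
   to those of {poly int}. *)
Definition fps_trunc n (u : fps) : {poly int} := \poly_(i < n.+1) u i.

Lemma fps_mul_trunc N (u v : fps) n : (n <= N)%N ->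
  fps_mul u v n = (fps_trunc N u * fps_trunc N v)`_n.
Proof.
move=> nN; rewrite coefM; apply: eq_bigr => i _; rewrite !coef_poly !ltnS.
have iN : (i <= N)%N by rewrite (leq_trans _ nN) // -ltnS.
by rewrite iN (leq_trans (leq_subr _ _) nN).
Qed.

Fact fps_mulA : associative fps_mul.
Proof.
move=> u v w; apply/fpsP => n.
transitivity (fps_trunc n u * fps_trunc n v * fps_trunc n w)`_n.
  rewrite -mulrA coefM; apply: eq_bigr => i _; rewrite coef_poly ltn_ord.
  by rewrite -fps_mul_trunc // leq_subr.
rewrite coefM; apply: eq_bigr => i _; rewrite -fps_mul_trunc -1?ltnS //.
by rewrite coef_poly ltnS leq_subr.
Qed.

Fact fps_mulC : commutative fps_mul.
Proof. by move=> u v; apply/fpsP => n; rewrite !(@fps_mul_trunc n) // mulrC. Qed.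

Fact fps_mul1 : left_id fps_one fps_mul.
Proof.
move=> u; apply/fpsP => n /=; rewrite big_ord_recl mul1r subn0 big1 ?addr0 //.
by move=> i _; rewrite mul0r.
Qed.

Fact fps_mulD : left_distributive fps_mul fps_add.
Proof.
move=> u v w; apply/fpsP => n /=; rewrite -big_split.
by apply: eq_bigr => i _; rewrite mulrDl.
Qed.

Fact fps_one_neq0 : fps_one != 0.
Proof. by apply/eqP => /fpsP /(_ 0%N). Qed.

HB.instance Definition _ := GRing.Zmodule_isComNzRing.Build fps
  fps_mulA fps_mulC fps_mul1 fps_mulD fps_one_neq0.

Lemma fps0E n : (0 : fps) n = 0. Proof. by []. Qed.
Lemma fps1E n : (1 : fps) n = (n == 0%N)%:R. Proof. by []. Qed.
Lemma fpsDE (u v : fps) n : (u + v) n = u n + v n. Proof. by []. Qed.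
Lemma fpsME (u v : fps) n : (u * v) n = \sum_(i < n.+1) u i * v (n - i)%N.
Proof. by []. Qed.

Lemma fpsM0E (u v : fps) : (u * v) 0%N = u 0%N * v 0%N.
Proof. by rewrite fpsME big_ord_recl big_ord0 addr0. Qed.

Lemma fpsX0E (u : fps) k : (u ^+ k) 0%N = u 0%N ^+ k.
Proof. by elim: k => [|k IHk]; rewrite ?expr0 // !exprS fpsM0E IHk. Qed.

Definition fpsX : fps := FPS (fun n => (n == 1%N)%:R).

(* u / x, meaningful when u has zero constant term (see fps_divXK). *)
Definition fps_divX (u : fps) : fps := FPS (fun n => u n.+1).

Lemma fpsXM (u : fps) n : (fpsX * u) n = if n is m.+1 then u m else 0.
Proof.
rewrite fpsME; case: n => [|n]; first by rewrite big_ord_recl big_ord0 mul0r.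
rewrite big_ord_recl mul0r add0r big_ord_recl mul1r subSS subn0 big1 ?addr0 //.
by move=> i _; rewrite mul0r.
Qed.

Lemma fps_divXK (u : fps) : u 0%N = 0 -> fpsX * fps_divX u = u.
Proof. by move=> u0; apply/fpsP => -[|n]; rewrite fpsXM. Qed.

(* h(f(x)), meaningful when f has zero constant term: then f^k has no
   coefficient below x^k, so that the sum over k may stop at n. *)
Definition fps_comp (h f : fps) : fps :=
  FPS (fun n => \sum_(k < n.+1) h k * (f ^+ k) n).

Lemma fps_exp_small (f : fps) k n :
  f 0%N = 0 -> (n < k)%N -> (f ^+ k) n = 0.
Proof.
move=> f0; elim: k n => // k IHk n; rewrite ltnS exprS fpsME => nk.
rewrite big_ord_recl f0 mul0r add0r big1 // => i _; rewrite IHk ?mulr0 //.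
by apply: leq_trans nk; rewrite ltn_subrL /=; case: n i => [[]|].
Qed.

Lemma fps_comp_widen (h f : fps) N n : f 0%N = 0 -> (n <= N)%N ->
  fps_comp h f n = \sum_(k < N.+1) h k * (f ^+ k) n.
Proof.
move=> f0 nN; rewrite -(subnKC nN) -addSn big_split_ord /=.
rewrite [X in _ = _ + X]big1 ?addr0 // => i _.
by rewrite (fps_exp_small f0) ?mulr0 // addSn ltnS leq_addr.
Qed.

Lemma fps_comp1 (f : fps) : fps_comp 1 f = 1.
Proof.
apply/fpsP => n /=; rewrite big_ord_recl mul1r big1 ?addr0 // => i _.
by rewrite mul0r.
Qed.

Lemma fps_compM (h l f : fps) : f 0%N = 0 ->
  fps_comp (h * l) f = fps_comp h f * fps_comp l f.
Proof.
move=> f0; apply/fpsP => n.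
pose c a b := h a * l b * (f ^+ (a + b)) n.
transitivity (\sum_(a < n.+1) \sum_(b < n.+1) c a b); last first.
  transitivity (\sum_(i < n.+1) \sum_(a < n.+1) \sum_(b < n.+1)
      (h a * (f ^+ a) i) * (l b * (f ^+ b) (n - i)%N)); last first.
    apply: eq_bigr => i _; have le_in : (i <= n)%N by rewrite -ltnS.
    rewrite (fps_comp_widen h f0 le_in) (fps_comp_widen l f0 (leq_subr i n)).
    by rewrite big_distrlr.
  rewrite [RHS]exchange_big; apply: eq_bigr => a _.
  rewrite [RHS]exchange_big; apply: eq_bigr => b _.
  by rewrite /c exprD fpsME big_distrr /=; apply: eq_bigr => i _; rewrite mulrACA.
rewrite /fps_comp /=.
transitivity (\sum_(k < n.+1) \sum_(a < n.+1 | (a <= k)%N) c a (k - a)%N).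
  apply: eq_bigr => k _; rewrite (big_ord_widen n.+1 (fun a => h a * l (k - a)%N)) //.
  rewrite big_distrl /=; apply: eq_bigr => a; rewrite ltnS => ak.
  by rewrite /c subnKC.
rewrite (exchange_big_dep xpredT) //=; apply: eq_bigr => a _.
have an : (a <= n)%N by rewrite -ltnS.
pose F k := c a (k - a)%N.
rewrite -(big_mkord (fun k => (a <= k)%N) F) (big_cat_nat (n := a)) //=; last exact: leqW.
rewrite big_nat_cond big1 ?add0r; last first.
  by move=> k /andP[/andP[_ ka] ak]; move: ka; rewrite ltnNge ak.
rewrite -{1}[nat_of_ord a]add0n big_addn big_mkcond /=.
under eq_bigr => k _ do rewrite leq_addl /F addnK.
have le_na : (n.+1 - a <= n.+1)%N by exact: leq_subr.
rewrite big_mkord (big_ord_widen n.+1 (c a)) // big_mkcond /=.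
apply: eq_bigr => b _; case: ifP => // /negbT; rewrite -leqNgt leq_subLR => nb.
by rewrite /c fps_exp_small ?mulr0.
Qed.

Lemma fps_compXn (h f : fps) k : f 0%N = 0 ->
  fps_comp (h ^+ k) f = fps_comp h f ^+ k.
Proof.
move=> f0; elim: k => [|k IHk]; first by rewrite !expr0 fps_comp1.
by rewrite !exprS fps_compM // IHk.
Qed.

(* The defining pair (g, f) of an ordinary Riordan array. *)
Record riordan := Riordan {
  riordan_g : fps;
  riordan_f : fps;
  riordan_g0 : riordan_g 0%N = 1;
  riordan_f0 : riordan_f 0%N = 0;
  riordan_f1 : riordan_f 1%N = 1
}.

(* The general term T_{n,k} = [x^n] g(x) f(x)^k. *)
Definition riordan_coef (R : riordan) (n k : nat) : int :=
  (riordan_g R * riordan_f R ^+ k) n.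
Coercion riordan_coef : riordan >-> Funclass.

Lemma riordan_small (R : riordan) n k : (n < k)%N -> R n k = 0.
Proof.
move=> nk; rewrite /riordan_coef fpsME big1 // => i _.
rewrite fps_exp_small ?mulr0 ?riordan_f0 //.
by rewrite (leq_ltn_trans (leq_subr _ _)).
Qed.

Section RiordanProduct.
Variables R S : riordan.
Let g := riordan_g R.
Let f := riordan_f R.
Let h := riordan_g S.
Let l := riordan_f S.

Fact riordan_mul_g0 : (g * fps_comp h f) 0%N = 1.
Proof.
by rewrite fpsM0E /= big_ord_recl big_ord0 addr0 /g /h !riordan_g0 expr0.
Qed.
Fact riordan_mul_f0 : fps_comp l f 0%N = 0.
Proof. by rewrite /= big_ord_recl big_ord0 addr0 /l riordan_f0 mul0r. Qed.
Fact riordan_mul_f1 : fps_comp l f 1%N = 1.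
Proof.
by rewrite /= !big_ord_recl big_ord0 /l riordan_f0 riordan_f1 mul0r add0r addr0
  mul1r expr1 /f riordan_f1.
Qed.

(* (g, f) . (h, l) = (g (h o f), l o f) *)
Definition riordan_mul := Riordan riordan_mul_g0 riordan_mul_f0 riordan_mul_f1.

(* The product of Riordan arrays is the product of lower-triangular matrices;
   in particular it depends only on the arrays. *)
Lemma riordan_mulE n k : riordan_mul n k = \sum_(j < n.+1) R n j * S j k.
Proof.
have f0 : f 0%N = 0 by exact: riordan_f0.
transitivity ((g * fps_comp (h * l ^+ k) f) n).
  by rewrite fps_compM // fps_compXn // mulrA.
rewrite fpsME.
under eq_bigr => i _ do
  rewrite (@fps_comp_widen _ _ n) ?leq_subr // big_distrr /=.
rewrite exchange_big; apply: eq_bigr => j _.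
rewrite /riordan_coef -/g -/f -/h -/l (fpsME g) big_distrl /=.
by apply: eq_bigr => i _; rewrite mulrCA mulrC.
Qed.

End RiordanProduct.

(* Main.v *)
Require Import Defs.
From mathcomp Require Import all_boot all_order all_algebra ring.

Import GRing.Theory.
Local Open Scope ring_scope.

(** Since f^2 = x u with u = f^2/x, one has f^(2k) = x^k u^k, and multiplying by
    x^k merely shifts coefficients: [x^(n+k)] g f^(2k) = [x^n] g u^k. Likewise
    f^(2k+1) = x^(k+1) (f/x) u^k. As x is neutral for composition, the product
    (f/x, x) . (g, u) is (g f/x, u). *)

Lemma fpsXnM (u : fps) k n : (fpsX ^+ k * u) (n + k)%N = u n.
Proof.
elim: k => [|k IHk]; first by rewrite expr0 mul1r addn0.
by rewrite exprS -mulrA addnS fpsXM.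
Qed.

Lemma fpsXnE k n : (fpsX ^+ k) n = (n == k)%:R.
Proof.
elim: k n => [|k IHk] n; first by rewrite expr0 fps1E.
by rewrite exprS fpsXM; case: n.
Qed.

Lemma fps_compX (h : fps) : fps_comp h fpsX = h.
Proof.
(* Only the last index k = n of the truncated sum contributes, since x^k has no other
   coefficient. *)
apply/fpsP => n /=; rewrite big_ord_recr /= fpsXnE eqxx mulr1 big1 ?add0r //.
by move=> i _; rewrite fpsXnE gtn_eqF ?mulr0.
Qed.

(** Together with [fps_sqr2], this lets f^2/x serve as the second component of a Riordan array when
    f_1 = 1. *)
Lemma fps_sqr1 (f : fps) : f 0%N = 0 -> (f ^+ 2) 1%N = 0.
Proof. by move=> f0; rewrite fps_exp_small. Qed.

Lemma fps_sqr2 (f : fps) : f 0%N = 0 -> (f ^+ 2) 2 = f 1%N ^+ 2.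
Proof.
move=> f0; rewrite expr2 fpsME !big_ord_recl big_ord0 /= f0.
by rewrite mulr0 mul0r !addr0 add0r.
Qed.

Lemma fps_exp_double (f : fps) k : f 0%N = 0 ->
  f ^+ (2 * k) = fpsX ^+ k * fps_divX (f ^+ 2) ^+ k.
Proof.
by move=> f0; rewrite exprM -exprMn fps_divXK // fpsX0E f0 expr0n.
Qed.

Lemma riordan_coef_even (R : riordan) n k :
  R (n + k)%N (2 * k)%N =
  (riordan_g R * fps_divX (riordan_f R ^+ 2) ^+ k) n.
Proof.
by rewrite /riordan_coef fps_exp_double ?riordan_f0 // mulrCA fpsXnM.
Qed.

Lemma riordan_coef_odd (R : riordan) n k :
  R (n + k + 1)%N (2 * k + 1)%N =
  (riordan_g R * fps_divX (riordan_f R) * fps_divX (riordan_f R ^+ 2) ^+ k) n.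
Proof.
(* The shift is by k + 1: k factors x come from f^(2k) and one from the remaining f. *)
rewrite -addnA !addn1 -[RHS](fpsXnM _ k.+1); congr (coef_fps _ _).
have f0 := riordan_f0 R.
rewrite exprSr fps_exp_double // -[X in _ * (_ * X)](fps_divXK f0).
by rewrite (exprS fpsX); ring.
Qed.

Theorem mainTheorem1 (R : riordan) (A B : nat -> nat -> int)
  (hA : forall n k : nat, A n k = R (n + k)%N (2 * k)%N)
  (hB : forall n k : nat, B n k = R (n + k + 1)%N (2 * k + 1)%N) :
  let g := riordan_g R in
  let f := riordan_f R in
  exists RA RB C : riordan,
    [/\ [/\ riordan_g RA = g,
            riordan_f RA = fps_divX (f ^+ 2)
          & forall n k : nat, A n k = RA n k],
        [/\ riordan_g RB = g * fps_divX f,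
            riordan_f RB = fps_divX (f ^+ 2)
          & forall n k : nat, B n k = RB n k],
        riordan_g C = fps_divX f /\ riordan_f C = fpsX
      & forall n k : nat, B n k = riordan_mul C RA n k].
Proof.
move=> g f.
have u0 : fps_divX (f ^+ 2) 0%N = 0 by apply: fps_sqr1; apply: riordan_f0.
have u1 : fps_divX (f ^+ 2) 1%N = 1.
  by apply: etrans (fps_sqr2 _ (riordan_f0 R)) _; rewrite riordan_f1 expr1n.
have h0 : fps_divX f 0%N = 1 by apply: riordan_f1.
have gh0 : (g * fps_divX f) 0%N = 1 by rewrite fpsM0E riordan_g0 h0 mulr1.
exists (Riordan (riordan_g0 R) u0 u1), (Riordan gh0 u0 u1).
exists (@Riordan (fps_divX f) fpsX h0 erefl erefl).
(* This form settles the claim on [RB] by conversion and also starts the product formula. *)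
have hBu n k : B n k = (g * fps_divX f * fps_divX (f ^+ 2) ^+ k) n.
  by rewrite hB riordan_coef_odd.
split=> //.
- by split=> // n k; rewrite hA riordan_coef_even.
(* The product has first component (f/x) (g o x), so g is first moved to the right of f/x. *)
- by move=> n k; rewrite hBu (mulrC g) /riordan_coef [riordan_g _]/= [riordan_f _]/= !fps_compX.
Qed.
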